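(* For all non-negative integers $m$ and $n$ with $m\ge 2n$, \[ \sum_{\vec s\in C_{2n+1}(m-2n)}\mathscr{C}(\vec s) = Z(m)\times|C_{2n+1}(m-2n)| = Z(m)\binom{m}{2n}. \]
   Context: For positive integers $s_1,\dots,s_k$ with $s_1>1$, the multiple zeta value is $\zeta(s_1,\dots,s_k):=\sum_{n_1>n_2>\cdots>n_k>0}\prod_{j=1}^k n_j^{-s_j}$; for the empty argument string ($k=0$) its value is $1$. The notation $\{2\}^{r}$ in an argument string means $r$ consecutive arguments equal to $2$ (none if $r=0$). For non-negative integers $k$ and $r$, $C_r(k)$ denotes the set of ordered $r$-tuples of non-negative integers with sum $k$. For a non-negative integer $n$ and a vector $\vec s=(m_0,m_1,\dots,m_{2n})$ of non-negative integers, define \[ Z(\vec s)=Z(m_0,\dots,m_{2n}):=\zeta(\{2\}^{m_0},3,\{2\}^{m_1},1,\{2\}^{m_2},3,\{2\}^{m_3},1,\dots,3,\{2\}^{m_{2n-1}},1,\{2\}^{m_{2n}}), \] i.e. $m_j$ consecutive twos are inserted after the $j$th element of the string $3,1,3,1,\dots,3,1$ ($n$ repetitions of $3,1$) for $j=0,1,\dots,2n$. In particular, for $n=0$ and a single non-negative integer $m$, $Z(m)=\zeta(\{2\}^m)$. The cyclic sum is \[ \mathscr{C}(\vec s):=Z(\vec s)+\sum_{j=1}^{2n} Z(m_j,m_{j+1},\dots,m_{2n},m_0,\dots,m_{j-1}), \] the sum of the $2n+1$ $Z$-values over all cyclic shifts of $\vec s$ (counted with multiplicity). *)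

(* Defs.v *)
From HB Require Import structures.
From mathcomp Require Import all_boot all_order all_algebra.
From mathcomp Require Import all_classical all_reals all_analysis.

Set Implicit Arguments.
Unset Strict Implicit.
Unset Printing Implicit Defensive.

Import Order.TTheory GRing.Theory Num.Theory.

Local Open Scope classical_set_scope.
Local Open Scope ring_scope.

(* The terms are nonnegative, so the order of summation is irrelevant. The sum
   is finite when s is empty or its head is > 1 with all entries > 0; if it is
   infinite, [fine] returns the junk value 0. *)
Definition mzv (R : realType) (s : seq nat) : R :=
  fine (\esum_(n in [set n : (size s).-tuple nat |
                       sorted gtn n && all (ltn 0%N) n])
          ((\prod_(j < size s) (tnth n j)%:R ^- nth 0%N s j)%R%:E : \bar R)).

Definition Zarg (n : nat) (s : (n.*2.+1).-tuple nat) : seq nat :=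
  nseq (nth 0%N s 0) 2%N ++
  flatten [seq 3%N :: nseq (nth 0%N s i.*2.+1) 2%N ++
               1%N :: nseq (nth 0%N s i.*2.+2) 2%N | i <- iota 0 n].

Definition Z (R : realType) (n : nat) (s : (n.*2.+1).-tuple nat) : R :=
  mzv R (Zarg s).

Definition cyclic_sum (R : realType) (n : nat) (s : (n.*2.+1).-tuple nat) : R :=
  Z R s + \sum_(1 <= j < n.*2.+1) Z R [tuple of rot j s].

(* Entries of an r-tuple with sum k are at most k, so bounding them by k loses
   nothing and makes C_r(k) a finite set. *)
Definition compositions (r k : nat) : {set r.-tuple 'I_k.+1} :=
  [set s : r.-tuple 'I_k.+1 | (\sum_(j < r) (tnth s j : nat))%N == k]%SET.

Definition nat_tuple (r k : nat) (s : r.-tuple 'I_k) : r.-tuple nat :=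
  [tuple of [seq val i | i <- s]].

(* Main.v *)
(* Write a word in the alphabet of the forms x = dt/t and y = dt/(1-t) and
   represent a multiple polylogarithm by the sequence of its power series
   coefficients, all of them nonnegative. The product of the series of
   [(xy)^p] and [(xy)^q] is computed by the Leibniz rule; summed with weights
   X^p Y^q over p + q = m, where X + Y = 1, it obeys the same recursion as
     \sum_k (4XY)^k T_(m,k),
   where T_(m,k) is the sum of the series of all words obtained from
   {3,1}^k by inserting m - 2k twos. Summing all coefficients gives
     \sum_(p+q=m) X^p Y^q zeta({2}^p) zeta({2}^q)
       = \sum_k (4XY)^k \sum_(s in C_(2k+1)(m-2k)) Z(s).
   Cauchy's cotangent argument yields zeta({2}^p) = pi^(2p) / (2p+1)!, so with
   X = a^2 and Y = b^2 the left-hand side is an explicit polynomial in 4XY, by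
   (b + a)^(2m+2) - (b - a)^(2m+2) = (1 + 2ab)^(m+1) - (1 - 2ab)^(m+1).
   Comparing coefficients gives \sum_s Z(s) = zeta({2}^m) 'C(m,2k) / (2k+1),
   and cyclic shifts permute the compositions. *)

Require Import Defs.
From HB Require Import structures.
From mathcomp Require Import all_boot all_order all_algebra.
From mathcomp Require Import all_classical all_reals all_analysis.
From mathcomp Require Import ring lra zify.

Set Implicit Arguments.
Unset Strict Implicit.
Unset Printing Implicit Defensive.

Import Order.TTheory GRing.Theory Num.Theory.
Import numFieldNormedType.Exports.

Local Open Scope ring_scope.

(** * Products of polylogarithm series *)

Section PowerSeries.
Variable R : realType.
Implicit Types f g : nat -> R.

Definition conv f g : nat -> R := fun n => \sum_(i < n.+1) f i * g (n - i)%N.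
Definition delta : nat -> R := fun n => (n == 0)%:R.
(** Multiplication of the power series by t/(1-t). The strict bound [j < n] is the source of the
    strict inequalities between summation indices. *)
Definition psum f : nat -> R := fun n => \sum_(j < n) f j.
(* Prefixing a word with [x] or [y]; the constant coefficient becomes 0 since
   [x / 0 = 0]. *)
Definition Ix f : nat -> R := fun n => f n / n%:R.
Definition Iy f : nat -> R := Ix (psum f).

Lemma convC f g : conv f g = conv g f.
Proof.
apply/funext => n; rewrite /conv (reindex_inj rev_ord_inj) /=.
apply: eq_bigr => i _; rewrite subSS mulrC subKn //.
by rewrite -ltnS.
Qed.

Fact scaleD_fctE (a : R) f g n : (a *: f + g) n = a * f n + g n.
Proof. by []. Qed.

Fact add_fctE f g n : (f + g) n = f n + g n. Proof. by []. Qed.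

Fact conv_linear f : linear (conv f).
Proof.
move=> a g h; apply/funext => n; rewrite scaleD_fctE /conv mulr_sumr -big_split /=.
by apply: eq_bigr => i _; rewrite scaleD_fctE mulrDr mulrCA.
Qed.
HB.instance Definition _ f :=
  GRing.isLinear.Build R (nat -> R) (nat -> R) *:%R (conv f) (conv_linear f).

Fact psum_linear : linear psum.
Proof.
move=> a g h; apply/funext => n; rewrite scaleD_fctE /psum mulr_sumr -big_split /=.
by apply: eq_bigr.
Qed.
HB.instance Definition _ :=
  GRing.isLinear.Build R (nat -> R) (nat -> R) *:%R psum psum_linear.

Fact Ix_linear : linear Ix.
Proof.
by move=> a g h; apply/funext => n; rewrite scaleD_fctE /Ix scaleD_fctE mulrDl mulrA.
Qed.
HB.instance Definition _ :=
  GRing.isLinear.Build R (nat -> R) (nat -> R) *:%R Ix Ix_linear.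
HB.instance Definition _ := GRing.Linear.copy Iy (Ix \o psum).

Lemma conv1f f : conv delta f = f.
Proof.
apply/funext => n; rewrite /conv big_ord_recl subn0 mul1r big1 ?addr0 //.
by move=> i _; rewrite mul0r.
Qed.

Lemma convf1 f : conv f delta = f. Proof. by rewrite convC conv1f. Qed.

Lemma conv0f f : conv 0 f = 0. Proof. by rewrite convC linear0. Qed.

Lemma psum0 f : psum f 0 = 0. Proof. by rewrite /psum big_ord0. Qed.

Lemma Ix0 f : Ix f 0 = 0. Proof. by rewrite /Ix invr0 mulr0. Qed.

Lemma Iy0 f : Iy f 0 = 0. Proof. exact: Ix0. Qed.

(** Multiplication by t/(1-t) commutes with the product of series; on coefficients, both sides have
    the same increments. *)
Lemma conv_psum f g : conv (psum f) g = psum (conv f g).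
Proof.
apply/funext; elim=> [|n IH].
  by rewrite /conv big_ord1 !psum0 mul0r.
have -> : psum (conv f g) n.+1 = psum (conv f g) n + conv f g n.
  by rewrite /psum big_ord_recr.
rewrite -IH /conv [LHS]big_ord_recl psum0 mul0r add0r -big_split /=.
apply: eq_bigr => i _; rewrite -mulrDl; congr (_ * _).
by rewrite /psum big_ord_recr.
Qed.

(* Integrates the product rule for the derivation [t d/dt]. *)
Lemma conv_Ix f g : f 0%N = 0 -> g 0%N = 0 ->
  conv (Ix f) (Ix g) = Ix (conv f (Ix g) + conv (Ix f) g).
Proof.
move=> f0 g0; apply/funext => n; case: n => [|n].
  by rewrite Ix0 /conv big_ord1 Ix0 mul0r.
rewrite {3}/Ix add_fctE /conv -big_split /Ix /=.
apply: (@mulIf _ n.+1%:R); first by rewrite pnatr_eq0.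
rewrite divfK ?pnatr_eq0 // mulr_suml; apply: eq_bigr => -[i /= lei] _.
have -> : n.+1%:R = i%:R + (n.+1 - i)%:R :> R by rewrite -natrD subnKC.
(* The split n + 1 = i + j is the product rule on a monomial. If i or j is 0, the convention x / 0 =
   0 blocks cancellation, but then [f 0] or [g 0] vanishes. *)
move: (n.+1 - i)%N => j; case: i {lei} => [|i]; case: j => [|j].
- by rewrite f0 !mul0r addr0.
- by rewrite f0 !mul0r addr0.
- by rewrite g0 !mul0r !mulr0 !mul0r addr0.
by field; rewrite -!(natrD _ 1) !add1n !pnatr_eq0.
Qed.

Lemma conv_IxIy f g : f 0%N = 0 ->
  conv (Ix f) (Iy g) = Ix (conv f (Iy g)) + Iy (conv (Ix f) g).
Proof.
by move=> f0; rewrite conv_Ix ?psum0// linearD/= [conv (Ix f) (psum _)]convC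
  conv_psum [conv g _]convC.
Qed.

Lemma conv_IyIy f g : conv (Iy f) (Iy g) = Iy (conv f (Iy g) + conv (Iy f) g).
Proof.
rewrite [Iy f]/(Ix (psum f)) conv_IxIy ?psum0// conv_psum -[Ix (psum f)]/(Iy f).
by rewrite -[Ix (psum _)]/(Iy _) -linearD.
Qed.

(* [Li2 p], [Li2sh p] and [Li12 p] are the series of the words [(xy)^p],
   [(xy)^(p-1)] and [y(xy)^(p-1)]; the last two are 0 for [p = 0]. *)
Fixpoint Li2 p : nat -> R := if p is p'.+1 then Ix (Iy (Li2 p')) else delta.
Definition Li2sh p : nat -> R := if p is p'.+1 then Li2 p' else 0.
Definition Li12 p := Iy (Li2sh p).

Lemma Li12_0 p : Li12 p 0 = 0. Proof. exact: Iy0. Qed.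
Lemma Li2S p : Li2 p.+1 = Ix (Li12 p.+1). Proof. by []. Qed.
Lemma Li120 : Li12 0 = 0. Proof. by rewrite /Li12 linear0. Qed.

Lemma conv_Li12_Li2 p q :
  conv (Li12 p) (Li2 q) = Iy (conv (Li2sh p) (Li2 q)) + Ix (conv (Li12 p) (Li12 q)).
Proof.
case: q => [|q]; first by rewrite Li120 !linear0 !convf1 addr0.
by rewrite Li2S convC conv_IxIy ?Li12_0// [conv (Li12 _) _]convC
  [conv (Ix _) _]convC addrC.
Qed.

Lemma conv_Li2_Li12 p q :
  conv (Li2 p) (Li12 q) = Iy (conv (Li2 p) (Li2sh q)) + Ix (conv (Li12 p) (Li12 q)).
Proof. by rewrite convC conv_Li12_Li2 [conv (Li2 p) _]convC [conv (Li12 p) _]convC. Qed.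

Lemma conv_Li2_Li2 p q : (0 < p + q)%N ->
  conv (Li2 p) (Li2 q) = Ix (conv (Li12 p) (Li2 q) + conv (Li2 p) (Li12 q)).
Proof.
case: p q => [|p] [|q] // _; rewrite ?Li120 ?conv0f ?linear0 ?add0r ?addr0.
- by rewrite !conv1f.
- by rewrite !convf1.
by rewrite !Li2S conv_Ix ?Li12_0.
Qed.

End PowerSeries.

(** * Weighted sums of products and their recursion *)

Section Products.
Variables (R : realType) (X Y : R).
Hypothesis XY1 : X + Y = 1.
Implicit Types h : nat -> nat -> nat -> R.
Let w := 4 * X * Y.

Definition hsum h m : nat -> R :=
  \sum_(p < m.+1) (X ^+ p * Y ^+ (m - p)) *: h p (m - p)%N.

Lemma eq_hsum h1 h2 m : (forall p q, (p + q = m)%N -> h1 p q = h2 p q) ->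
  hsum h1 m = hsum h2 m.
Proof.
by move=> e; apply: eq_bigr => p _; rewrite e // subnKC // -ltnS.
Qed.

Lemma hsumD h1 h2 m :
  hsum (fun p q => h1 p q + h2 p q) m = hsum h1 m + hsum h2 m.
Proof. by rewrite /hsum -big_split; apply: eq_bigr => p _; rewrite scalerDr. Qed.

Lemma linear_hsum (J : {linear (nat -> R) -> (nat -> R)}) h m :
  hsum (fun p q => J (h p q)) m = J (hsum h m).
Proof. by rewrite /hsum linear_sum; apply: eq_bigr => p _; rewrite linearZ. Qed.

Lemma hsum0 h : hsum h 0 = h 0%N 0%N.
Proof. by rewrite /hsum big_ord1 mulr1 scale1r. Qed.

Lemma hsum_shiftl h m : (forall q, h 0%N q = 0) ->
  hsum h m.+1 = X *: hsum (fun p => h p.+1) m.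
Proof.
move=> h0; rewrite /hsum big_ord_recl h0 scaler0 add0r scaler_sumr.
by apply: eq_bigr => p _; rewrite scalerA mulrA -exprS /= subSS.
Qed.

Lemma hsum_shiftr h m : (forall p, h p 0%N = 0) ->
  hsum h m.+1 = Y *: hsum (fun p q => h p q.+1) m.
Proof.
move=> h0; rewrite /hsum big_ord_recr/= subnn h0 scaler0 addr0 scaler_sumr.
apply: eq_bigr => p _; rewrite scalerA mulrCA -exprS /= subSn //.
by rewrite -ltnS.
Qed.

Definition LiP := hsum (fun p q => conv (Li2 R p) (Li2 R q)).
(** Companion of [LiP] that closes the recursion: by [hsum_Li12], [Iy (LiF m)] is twice the weighted
    sum of the products [conv (Li12 p) (Li12 q)]. *)
Definition LiF m :=
  2 *: hsum (fun p q => conv (Li2sh R p) (Li12 R q) + conv (Li12 R p) (Li2sh R q)) m.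

Lemma LiP0 : LiP 0 = delta R.
Proof. by rewrite /LiP hsum0 conv1f. Qed.

Lemma LiF0 : LiF 0 = 0.
Proof. by rewrite /LiF hsum0 /= conv0f linear0 addr0 scaler0. Qed.

Lemma hsum_Li12 m :
  2 *: hsum (fun p q => conv (Li12 R p) (Li12 R q)) m = Iy (LiF m).
Proof.
rewrite /LiF linearZ /= -(linear_hsum (@Iy R)); congr (_ *: _).
by apply: eq_hsum => p q _; rewrite conv_IyIy.
Qed.

Lemma LiPS m : LiP m.+1 = Ix (Iy (LiP m)) + Ix (Ix (Iy (LiF m.+1))).
Proof.
rewrite /LiP.
under (@eq_hsum _ _ m.+1) => p q pq
  do rewrite conv_Li2_Li2 ?pq// conv_Li12_Li2 conv_Li2_Li12 addrACA -linearD
             -[X in _ + X]linearD /=.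
rewrite (linear_hsum (@Ix R)) -(linearD (@Ix R)) -hsum_Li12; congr Ix.
rewrite hsumD (linear_hsum (@Iy R)) (linear_hsum (@Ix R)); congr (Iy _ + _).
  (* Shifting p in one half and q in the other leaves [LiP m] twice, with factors X and Y that add
     up to 1. *)
  rewrite hsumD hsum_shiftl => [|q]; last by rewrite conv0f.
  rewrite hsum_shiftr => [|q]; last by rewrite linear0.
  by rewrite /= -scalerDl XY1 scale1r.
by rewrite hsumD -mulr2n -scaler_nat.
Qed.

Lemma LiFS m : LiF m.+1 = Ix (Iy (LiF m)) +
  w *: Iy (if m is m'.+1 then LiP m' else 0).
Proof.
rewrite {1}/LiF hsumD hsum_shiftl => [|q]; last by rewrite conv0f.
rewrite hsum_shiftr => [|q]; last by rewrite linear0.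
under eq_hsum => p q _ do rewrite /= conv_Li2_Li12.
under [X in _ + _ *: X]eq_hsum => p q _ do rewrite /= conv_Li12_Li2.
rewrite !hsumD !(linear_hsum (@Iy R)) !(linear_hsum (@Ix R)) !scalerDr addrACA
  addrC !scalerA -(scalerDl (Ix _)) -mulrDr XY1.
rewrite mulr1 -(linearZ_LR (@Ix R)) hsum_Li12; congr (_ + _).
case: m => [|m]; first by rewrite !hsum0 /= conv0f !linear0 addr0.
(* The second shift acts on the other index, so each half carries XY; with the factor 2 in [LiF]
   this makes 4XY. *)
rewrite hsum_shiftr => [|q]; last by rewrite linear0.
rewrite hsum_shiftl => [|q]; last by rewrite conv0f.
rewrite -/LiP !linearZ /= !scalerA -scalerDl; congr (_ *: _).
by rewrite /w; ring.
Qed.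

End Products.

(** * Words and compositions *)

Section Words.
Variable R : realType.

(** Coefficients of the polylogarithm, the sum of t^(n_1) / (n_1^(s_1) ... n_k^(s_k)): the
    coefficient index is the largest summation index. *)
Fixpoint Li (s : seq nat) : nat -> R :=
  if s is a :: s' then fun n => psum (Li s') n * n%:R ^- a else delta R.

Lemma Li_1 s : Li (1 :: s)%N = Iy (Li s). Proof. by []. Qed.

Lemma Li_S a s : Li (a.+1 :: s) = Ix (Li (a :: s)).
Proof.
by apply/funext => n; rewrite /Ix /= exprSr invfM mulrCA mulrA [X in X * _]mulrC mulrC.
Qed.

Lemma Li_2 s : Li (2 :: s)%N = Ix (Iy (Li s)).
Proof. by rewrite Li_S// Li_1. Qed.

Lemma Li_3 s : Li (3 :: s)%N = Ix (Ix (Iy (Li s))).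
Proof. by rewrite Li_S// Li_2. Qed.

Lemma Li_nseq2 p : Li (nseq p 2%N) = Li2 R p.
Proof. by elim: p => // p IH; rewrite (Li_2 (nseq p 2%N)) IH. Qed.
End Words.

Section Comps.
Local Open Scope nat_scope.

Definition incr_head (s : seq nat) :=
  if s is a :: s' then a.+1 :: s' else [::].

(** A composition begins with 0 or arises by raising the first entry. For the word built from it,
    this decides whether a separator 3 or 1 comes first, or a 2. *)
Fixpoint comps r : nat -> seq (seq nat) :=
  if r is r'.+1 then
    fix comps_r k := [seq 0 :: s | s <- comps r' k] ++
                     (if k is k'.+1 then [seq incr_head s | s <- comps_r k'] else [::])
  else fun k => if k is 0 then [:: [::]] else [::].

Lemma compsS0 r : comps r.+1 0 = [seq 0 :: s | s <- comps r 0].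
Proof. by rewrite /= cats0. Qed.

Lemma compsSS r k :
  comps r.+1 k.+1 = [seq 0 :: s | s <- comps r k.+1] ++
                    [seq incr_head s | s <- comps r.+1 k].
Proof. by []. Qed.

Lemma mem_comps r k s : (s \in comps r k) = (size s == r) && (sumn s == k).
Proof.
elim: r k s => [|r IHr]; first by case=> [|k] [|a s].
elim=> [|k IHk] s.
  rewrite compsS0; apply/mapP/andP => [[t]|].
    by rewrite IHr => /andP[/eqP<- /eqP t0] -> /=; rewrite t0.
  case: s => [[]|a s [/eqP[szs]]] //=; rewrite addn_eq0 => /andP[/eqP-> s0].
  by exists s; rewrite // IHr szs eqxx s0.
rewrite compsSS mem_cat; apply/orP/andP.
  case=> /mapP[t]; rewrite ?IHr ?IHk => /andP[/eqP szt /eqP sumt] ->.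
    by rewrite /= szt sumt.
  by case: t szt sumt => //= a t -> <-.
case: s => [[]|[|a] s [szs sums]] //; [left|right]; apply/mapP.
  by exists s; rewrite // IHr -eqSS szs sums.
by exists (a :: s); rewrite // IHk /= szs -eqSS sums.
Qed.

Lemma comps_uniq r k : uniq (comps r k).
Proof.
elim: r k => [|r IHr]; first by case.
elim=> [|k IHk]; first by rewrite compsS0 map_inj_uniq// => s t [].
rewrite compsSS cat_uniq map_inj_uniq ?IHr => [|s t []//].
rewrite map_inj_in_uniq ?IHk ?andbT; last first.
  move=> [|a s] [|b t]; rewrite ?mem_comps // => _ _.
  by rewrite /incr_head => -[-> ->].
apply/hasPn => x /mapP[[|a s]]; rewrite mem_comps // => _ ->{x}.
by apply/mapP => -[].
Qed.

(* [b] tells whether the next entry to be inserted is a 3 or a 1. *)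
Fixpoint insert2 (b : bool) (s : seq nat) : seq nat :=
  if s is a :: s' then
    nseq a 2 ++ (if s' is [::] then [::]
                 else (if b then 3 else 1) :: insert2 (~~ b) s')
  else [::].

Lemma insert2_cons0 b s : s != [::] ->
  insert2 b (0 :: s) = (if b then 3 else 1) :: insert2 (~~ b) s.
Proof. by case: s. Qed.

Lemma insert2_incr_head b s : s != [::] -> insert2 b (incr_head s) = 2 :: insert2 b s.
Proof. by case: s. Qed.

Lemma Zarg_insert2 n (s : (n.*2.+1).-tuple nat) : Zarg s = insert2 true s.
Proof.
rewrite /Zarg; case: s => s /= /eqP; elim: n s => [|n IH] s.
  by case: s => [|a []] //= _; rewrite !cats0.
case: s => [|a [|b [|c s]]] //= [szs].
rewrite -/(insert2 true (c :: s)) -(IH (c :: s)) /= ?szs//.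
congr (_ ++ _ :: _); rewrite -catA; congr (_ ++ _ :: _ ++ _).
by rewrite -[1]addn0 iotaDl -map_comp.
Qed.

End Comps.

(** * Recursion for the sums over words with inserted twos *)

Section Generating.
Variable R : realType.

(** A string with [r] blocks of twos has r - 1 separators, alternating and ending in 1, so for r > 1
    the first is 3 exactly when [r] is odd. *)
Definition Liins r k : nat -> R := \sum_(s <- comps r k) Li R (insert2 (odd r) s).

Definition Li31 (r : nat) (f : nat -> R) := if odd r then Ix (Ix (Iy f)) else Iy f.

Lemma Liins10 : Liins 1 0 = delta R.
Proof. by rewrite /Liins big_seq1. Qed.

Lemma Li31_insert2 r s : Li31 r (Li R (insert2 (~~ odd r) s)) =
  Li R ((if odd r then 3%N else 1%N) :: insert2 (~~ odd r) s).
Proof. by rewrite /Li31; case: odd; rewrite ?Li_3. Qed.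

Lemma Li31_sum r T (l : seq T) (F : T -> nat -> R) :
  Li31 r (\sum_(x <- l) F x) = \sum_(x <- l) Li31 r (F x).
Proof. by rewrite /Li31; case: odd; rewrite !linear_sum. Qed.

Lemma comps_neq_nil r k s : s \in comps r.+1 k -> s != [::].
Proof. by rewrite mem_comps; case: s. Qed.

Lemma Liins_cons0 r k :
  \sum_(s <- [seq 0%N :: s | s <- comps r.+1 k]) Li R (insert2 (odd r.+2) s) =
  Li31 r.+2 (Liins r.+1 k).
Proof.
rewrite Li31_sum big_map big_seq [RHS]big_seq; apply: eq_bigr => s /comps_neq_nil s0.
by rewrite insert2_cons0 // -Li31_insert2 [odd r.+2]/= negbK.
Qed.

Lemma Liins_S0 r : Liins r.+2 0 = Li31 r.+2 (Liins r.+1 0).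
Proof. by rewrite {1}/Liins compsS0 Liins_cons0. Qed.

Lemma Liins_incr_head r k :
  \sum_(s <- [seq incr_head s | s <- comps r.+1 k]) Li R (insert2 (odd r.+1) s) =
  Ix (Iy (Liins r.+1 k)).
Proof.
rewrite /Liins !linear_sum big_map big_seq [RHS]big_seq.
apply: eq_bigr => s /comps_neq_nil s0.
by rewrite insert2_incr_head // Li_2.
Qed.

Lemma Liins_SS r k :
  Liins r.+2 k.+1 = Li31 r.+2 (Liins r.+1 k.+1) + Ix (Iy (Liins r.+2 k)).
Proof. by rewrite {1}/Liins compsSS big_cat Liins_cons0 Liins_incr_head. Qed.

Lemma Liins_1S k : Liins 1 k.+1 = Ix (Iy (Liins 1 k)).
Proof. by rewrite -Liins_incr_head {1}/Liins compsSS. Qed.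

Definition LiT m k := if (k.*2 <= m)%N then Liins k.*2.+1 (m - k.*2) else 0.
(** The words of [LiT m k] that begin with 3, with this 3 removed; there are none for k = 0. *)
Definition LiQ m k := if (0 < k.*2 <= m)%N then Liins k.*2 (m - k.*2) else 0.

Lemma LiT_S m k : LiT m.+1 k = Ix (Iy (LiT m k)) + Ix (Ix (Iy (LiQ m.+1 k))).
Proof.
rewrite /LiT /LiQ; case: k => [|k]; first by rewrite !subn0 Liins_1S !linear0 addr0.
rewrite doubleS ltnS /= subSS; case: (ltngtP k.*2.+1 m) => [lt|gt|<-].
- by rewrite -(subnSK lt) Liins_SS /Li31 /= odd_double addrC.
- by rewrite !linear0 addr0.
- by rewrite subnn Liins_S0 /Li31 /= odd_double !linear0 add0r.
Qed.

Lemma LiQ_0 k : LiQ 0 k = 0.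
Proof. by rewrite /LiQ; case: k. Qed.

Lemma LiQ_m0 m : LiQ m 0 = 0. Proof. by []. Qed.

Lemma LiQ_S m k : LiQ m.+1 k.+1 =
  Ix (Iy (LiQ m k.+1)) + Iy (if m is m'.+1 then LiT m' k else 0).
Proof.
rewrite /LiT /LiQ doubleS ltnS /=; case: m => [|m]; first by rewrite !linear0 addr0.
rewrite !ltnS !subSS; case: (ltngtP k.*2 m) => [lt|gt|<-].
- by rewrite -(subnSK lt) Liins_SS /Li31 /= odd_double addrC.
- by rewrite !linear0 addr0.
- by rewrite subnn Liins_S0 /Li31 /= odd_double !linear0 add0r.
Qed.



Variables (X Y : R).
Hypothesis XY1 : X + Y = 1.
Let w := 4 * X * Y.

(* Both sides obey the recursion [LiPS], [LiFS]; [N] is any bound past which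
   the terms vanish. *)
Lemma LiPF_expansion N m : (m < N)%N ->
  LiP X Y m = \sum_(k < N) w ^+ k *: LiT m k /\
  LiF X Y m = \sum_(k < N) w ^+ k *: LiQ m k.
Proof.
elim/ltn_ind: m => m IH ltmN; case: m => [|m] in IH ltmN *.
  case: N ltmN {IH} => // N _.
  rewrite LiP0 LiF0 !big_ord_recl; split.
    rewrite big1 => [|i _]; last by rewrite /LiT /= scaler0.
    by rewrite /LiT /= Liins10 scale1r addr0.
  by rewrite big1 => [|i _]; rewrite LiQ_0 scaler0// addr0.
have [IHP IHF] := IH m (leqnn _) (ltnW ltmN).
have EF : LiF X Y m.+1 = \sum_(k < N) w ^+ k *: LiQ m.+1 k.
  rewrite (LiFS XY1) IHF; case: N ltmN {IHP IHF} IH => // N ltmN IH.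
  rewrite [in RHS]big_ord_recl LiQ_m0 scaler0 add0r.
  under [X in _ = X]eq_bigr => k _ do rewrite LiQ_S scalerDr exprS -!(scalerA w).
  rewrite big_split /=; congr (_ + _).
    rewrite big_ord_recl LiQ_m0 scaler0 add0r (linear_sum (@Iy R)) (linear_sum (@Ix R)).
    apply: eq_bigr => k _.
    by rewrite (linearZ_LR (@Iy R)) (linearZ_LR (@Ix R)) scalerA -exprS.
  rewrite -scaler_sumr; congr (_ *: _).
  case: m IH ltmN => [_ _|m IH ltmN]; first by rewrite linear0 big1 // => k _; rewrite scaler0.
  have [-> _] := IH m (leqW (leqnn _)) (ltnW (ltnW ltmN)).
  (* The index shift in k leaves one surplus term, which vanishes since 2N > m. *)
  rewrite big_ord_recr /= [LiT m N]/LiT ifF; last by apply/negbTE; lia.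
  rewrite scaler0 addr0 linear_sum.
  by apply: eq_bigr => k _; rewrite linearZ_LR.
split=> //; rewrite (LiPS XY1) IHP EF !(linear_sum (@Iy R)) !(linear_sum (@Ix R)) -big_split.
by apply: eq_bigr => k _; rewrite LiT_S scalerDr
  !(linearZ_LR (@Iy R)) !(linearZ_LR (@Ix R)).
Qed.

End Generating.

(** * Summation of nonnegative series *)

Section Totals.
Variable R : realType.
Implicit Types f g : nat -> R.
Local Open Scope classical_set_scope.

(** Bounding partial sums gives one inequality for every nonnegative constant; the reverse one is
    the same bound for c^-1, with c = 0 treated apart. *)
Lemma esumZl (T : choiceType) (D : set T) (c : R) (F : T -> \bar R) :
  0 <= c -> (forall i, (0 <= F i)%E) ->
  \esum_(i in D) (c%:E * F i)%E = (c%:E * \esum_(i in D) F i)%E.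
Proof.
move=> c0 F0.
have esumZl_le x (G : T -> \bar R) : 0 <= x -> (forall i, (0 <= G i)%E) ->
    (\esum_(i in D) (x%:E * G i) <= x%:E * \esum_(i in D) G i)%E.
  move=> x0 G0; apply: ge_ereal_sup => _ [A fA <-].
  rewrite -ge0_mule_fsumr//; apply: lee_wpmul2l; first by rewrite lee_fin.
  by apply: ereal_sup_ubound; exists A.
apply/eqP; rewrite eq_le esumZl_le//=.
have [->|cn0] := eqVneq c 0.
  by rewrite mul0e; apply: esum_ge0 => i _; rewrite mul0e.
have K (x : \bar R) : x = (c^-1%:E * (c%:E * x))%E.
  by rewrite muleA -EFinM mulVf// mul1e.
under eq_esum => i _ do rewrite (K (F i)).
rewrite [leRHS](_ : _ = c%:E * (c^-1%:E * \esum_(i in D) (c%:E * F i)))%E; last first.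
  by rewrite muleA -EFinM mulfV// mul1e.
apply: lee_wpmul2l; rewrite ?lee_fin//; apply: esumZl_le; rewrite ?invr_ge0// => i.
by rewrite mule_ge0// lee_fin.
Qed.

Definition total f : \bar R := \esum_(n in [set: nat]) (f n)%:E.

Lemma total_ge0 f : (forall n, 0 <= f n) -> (0 <= total f)%E.
Proof. by move=> f0; apply: esum_ge0 => n _; rewrite lee_fin. Qed.

Lemma total_delta : total (delta R) = 1%E.
Proof.
rewrite /total (esumID [set 0%N]); last by move=> n _; rewrite lee_fin /delta ler0n.
rewrite setTI esum_set1 ?lee_fin ?ler0n// esum1 ?adde0// => -[|n] [_ //].
by move=> /(_ erefl).
Qed.

Lemma totalZ c f : 0 <= c -> (forall n, 0 <= f n) -> total (c *: f) = (c%:E * total f)%E.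
Proof.
by move=> c0 f0; rewrite /total -esumZl// => n; rewrite lee_fin.
Qed.

Lemma total_sum (T : choiceType) (r : seq T) (F : T -> nat -> R) :
  (forall x n, 0 <= F x n) ->
  total (\sum_(x <- r) F x) = (\sum_(x <- r) total (F x))%E.
Proof.
move=> F0; rewrite -(@esum_sum _ _ _ _ _ _ (fun n x => (F x n)%:E)); last first.
  by move=> *; rewrite lee_fin.
by apply: eq_esum => n _; rewrite fct_sumE sumEFin.
Qed.

Lemma conv_ge0 f g : (forall n, 0 <= f n) -> (forall n, 0 <= g n) ->
  forall n, 0 <= conv f g n.
Proof. by move=> f0 g0 n; apply: sumr_ge0 => i _; rewrite mulr_ge0. Qed.

(** Cauchy product, by reindexing a nonnegative double sum along i + j = n. Finiteness of [total g]
    lets it be pulled out as a real factor. *)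
Lemma total_conv f g b : (forall n, 0 <= f n) -> (forall n, 0 <= g n) ->
  total g = b%:E -> total (conv f g) = (total f * total g)%E.
Proof.
move=> f0 g0 gb; have b0 : 0 <= b by rewrite -lee_fin -gb total_ge0.
transitivity (\esum_(i in [set: nat]) \esum_(j in [set: nat]) (f i * g j)%:E).
  rewrite esum_esum => [|*]; last by rewrite lee_fin mulr_ge0.
  rewrite (@reindex_esum _ _ _ ([set: nat] `*`` (fun n => `I_n.+1)) _
    (fun k => (k.2, k.1 - k.2)%N)) /=; last first.
    split => //= [[n i] [m j] /[!inE]/= -[_ lein] [_ lejm] [eij e]|[i j] _].
      by rewrite -eij ltnS in e lein lejm *; congr (_, _); rewrite -(subnK lein) e subnK.
    by exists (i + j, i)%N; rewrite /= ?addKn// ltnS leq_addr.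
  rewrite -(@esum_esum _ _ _ _ _ (fun n i => (f i * g (n - i)%N)%:E)); last first.
    by move=> *; rewrite lee_fin mulr_ge0.
  apply: eq_esum => n _; rewrite esum_fset //; last first.
    by move=> *; rewrite lee_fin mulr_ge0.
  by rewrite -fsbig_ord /conv sumEFin.
rewrite gb muleC -esumZl//; apply: eq_esum => i _.
by rewrite -gb muleC -esumZl.
Qed.

Lemma Li_ge0 s n : 0 <= Li R s n.
Proof.
elim: s n => [|a s IH] n /=; first exact: ler0n.
by rewrite mulr_ge0 ?sumr_ge0// invr_ge0 exprn_ge0.
Qed.

Definition mzv_term (s : seq nat) (t : (size s).-tuple nat) : R :=
  \prod_(j < size s) (tnth t j)%:R ^- nth 0%N s j.

Lemma mzv_term_ge0 s t : 0 <= @mzv_term s t.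
Proof. by apply: prodr_ge0 => j _; rewrite invr_ge0 exprn_ge0. Qed.

(** Splits off the largest index, restricted to [K]: an initial segment in the induction on tails,
    all naturals for the full zeta value. *)
Lemma esum_mzv_term_cons a s (K : set nat) :
  (forall k, \esum_(t in [set t : (size s).-tuple nat |
      sorted gtn (k :: t) && all (ltn 0%N) (k :: t)]) (@mzv_term s t)%:E =
    (psum (Li R s) k)%:E) ->
  \esum_(t in [set t : (size (a :: s)).-tuple nat |
      K (thead t) /\ sorted gtn t && all (ltn 0%N) t]) (@mzv_term (a :: s) t)%:E =
  \esum_(k in K) (Li R (a :: s) k)%:E.
Proof.
move=> IH.
rewrite (@reindex_esum _ _ _ (K `*`` (fun k => [set t : (size s).-tuple nat |
      sorted gtn (k :: t) && all (ltn 0%N) (k :: t)])) _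
   (fun kt => [tuple of kt.1 :: kt.2])); last first.
  split=> [[k t] [/= Kk H]|[k t] [k' t'] _ _ /= e|t].
  - by rewrite /thead tnth0.
  - by have := congr1 val e => /= -[-> /val_inj ->].
  case/tupleP: t => k t /=; rewrite /thead tnth0 => -[Kk H].
  by exists (k, t).
rewrite -(@esum_esum _ _ _ _ _
  (fun k (t : (size s).-tuple nat) => (@mzv_term (a :: s) [tuple of k :: t])%:E)); last first.
  by move=> *; rewrite lee_fin mzv_term_ge0.
apply: eq_esum => k Kk.
rewrite /= mulrC EFinM -IH -esumZl; first last.
- by move=> t; rewrite lee_fin mzv_term_ge0.
- by rewrite invr_ge0 exprn_ge0.
apply: eq_esum => t _; rewrite /mzv_term big_ord_recl /= tnth0 -EFinM.
by congr (_ * _)%:E; apply: eq_bigr => j _; rewrite tnthS.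
Qed.

Lemma esum_mzv_term_lt s k :
  \esum_(t in [set t : (size s).-tuple nat |
      sorted gtn (k :: t) && all (ltn 0%N) (k :: t)]) (@mzv_term s t)%:E =
    (psum (Li R s) k)%:E.
Proof.
elim: s k => [|a s IH] k.
  case: k => [|k].
    by rewrite psum0 esum1 => // t /=; rewrite andbF.
  rewrite (_ : [set _ | _] = [set [tuple]]); last first.
    by apply/seteqP; split => t //= _; rewrite [t]tuple0.
  rewrite esum_set1 ?lee_fin ?mzv_term_ge0// /mzv_term big_ord0.
  by rewrite /psum big_ord_recl big1 ?addr0.
transitivity (\esum_(i in `I_k) (Li R (a :: s) i)%:E); last first.
  rewrite esum_fset //; last by move=> *; rewrite lee_fin Li_ge0.
  by rewrite -fsbig_ord sumEFin.
rewrite -esum_mzv_term_cons//; congr esum; apply/seteqP; split; case/tupleP => i t /=.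
  by rewrite /thead tnth0 => /andP[/andP[-> ->] /and3P[_ -> ->]].
rewrite /thead tnth0 => -[ik /andP[-> /andP[i0 ->]]].
by rewrite ik i0 (leq_ltn_trans _ ik).
Qed.

Lemma mzv_total s : mzv R s = fine (total (Li R s)).
Proof.
rewrite /mzv; congr fine; case: s => [|a s].
  rewrite (_ : [set _ | _] = [set [tuple]]); last first.
    by apply/seteqP; split => t //= _; rewrite [t]tuple0.
  by rewrite esum_set1 ?lee_fin ?big_ord0// [RHS]total_delta.
rewrite /total -esum_mzv_term_cons; last exact: esum_mzv_term_lt.
by congr esum; apply/seteqP; split => t //= -[].
Qed.

End Totals.

(** * Elementary symmetric functions and binomial sums *)

Section ElementarySymmetric.
Local Open Scope classical_set_scope.
Variable R : realType.
Implicit Types f g : nat -> R.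

Definition esympoly f N : {poly R} := \prod_(k < N) (1 + f k *: 'X).
Definition esymn f N p : R := (esympoly f N)`_p.

Lemma esymn0 f N : esymn f N 0 = 1.
Proof.
rewrite /esymn /esympoly -horner_coef0 horner_prod big1 // => k _.
by rewrite !hornerE.
Qed.

Lemma esymn0S f p : esymn f 0 p.+1 = 0.
Proof. by rewrite /esymn /esympoly big_ord0 coef1. Qed.

Lemma esymnSS f N p : esymn f N.+1 p.+1 = esymn f N p.+1 + f N * esymn f N p.
Proof.
by rewrite /esymn /esympoly big_ord_recr /= mulrDr mulr1 coefD -scalerAr coefZ coefMX.
Qed.

Lemma size_esympoly f N : (size (esympoly f N) <= N.+1)%N.
Proof.
apply/leq_sizeP; elim: N => [|N IH] [|p] // ltNp; rewrite -/(esymn _ _ _).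
  exact: esymn0S.
by rewrite esymnSS [esymn _ _ _]IH ?[esymn _ _ p]IH ?mulr0 ?addr0 // ltnW.
Qed.

Lemma esymn_ge0 f N p : (forall k, (k < N)%N -> 0 <= f k) -> 0 <= esymn f N p.
Proof.
elim: N p => [|N IH] [|p] f0; rewrite ?esymn0 ?esymn0S ?esymnSS//.
by rewrite addr_ge0 ?mulr_ge0 ?IH ?f0// => k kN; rewrite f0 ?leqW.
Qed.

Lemma le_esymn f g N p : (forall k, (k < N)%N -> 0 <= f k <= g k) ->
  esymn f N p <= esymn g N p.
Proof.
elim: N p => [|N IH] [|p] fg; rewrite ?esymn0 ?esymn0S ?esymnSS//.
have fgN k : (k < N)%N -> 0 <= f k <= g k by move=> kN; apply/fg/leqW.
have /andP[f0 fgle] := fg N (leqnn _).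
by rewrite lerD ?IH// ler_pM ?IH// esymn_ge0// => k /fgN /andP[].
Qed.

Lemma esymn_widen f M N p : (forall k, (k < N)%N -> 0 <= f k) -> (M <= N)%N ->
  esymn f M p <= esymn f N p.
Proof.
elim: N p => [|N IH] p f0; first by rewrite leqn0 => /eqP->.
rewrite leq_eqVlt => /predU1P[-> //|]; rewrite ltnS => MN.
case: p => [|p]; first by rewrite !esymn0.
rewrite esymnSS (le_trans (IH _ _ MN)) ?lerDl ?mulr_ge0 ?f0 ?esymn_ge0// => k kN.
all: by rewrite f0 ?leqW.
Qed.

Lemma esymnZ c f N p : esymn (c *: f) N p = c ^+ p * esymn f N p.
Proof.
elim: N p => [|N IH] [|p]; rewrite ?esymn0 ?esymn0S ?mulr0 ?mulr1// !esymnSS !IH.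
by rewrite -[(c *: f) N]/(c * f N) exprS; ring.
Qed.

Lemma cvg_esymn (F : nat -> nat -> R) f N p :
  (forall k, F M k @[M --> \oo] --> f k) ->
  esymn (F M) N p @[M --> \oo] --> esymn f N p.
Proof.
move=> Ff; elim: N p => [|N IH] [|p].
1,3: by under eq_cvg do rewrite esymn0; rewrite esymn0; exact: cvg_cst.
  by under eq_cvg do rewrite esymn0S; rewrite esymn0S; exact: cvg_cst.
under eq_cvg do rewrite esymnSS; rewrite esymnSS.
by apply: cvgD => //; apply: cvgM.
Qed.

(** Truncation of zeta({2}^p) to indices at most N. Sorting the terms by whether the largest index
    equals N is the recursion [esymnSS]. *)
Lemma psum_Li2 p N : psum (Li2 R p) N.+1 = esymn (fun k => k.+1%:R ^- 2) N p.
Proof.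
elim: p N => [|p IH] N.
  rewrite esymn0 /psum big_ord_recl big1 ?addr0 // => i _.
elim: N => [|N IHN]; first by rewrite esymn0S /psum big_ord1 [LHS]Ix0.
rewrite esymnSS -IHN -IH /psum big_ord_recr /=; congr (_ + _).
by rewrite /Ix /Iy /Ix -/(psum _ _) -mulrA -invfM mulrC.
Qed.

End ElementarySymmetric.

Section OddEvenBinomials.
Variable R : realType.

(** Even and odd parts of (1 + x)^n, as polynomials in x^2; Pascal's rule then expresses
    multiplication by 1 + x. *)
Definition evenbin n : {poly R} := \poly_(j < n.+1) 'C(n, j.*2)%:R.
Definition oddbin n : {poly R} := \poly_(j < n.+1) 'C(n, j.*2.+1)%:R.

Lemma coef_evenbin n j : (evenbin n)`_j = 'C(n, j.*2)%:R.
Proof. by rewrite coef_poly; case: ltnP => // nj; rewrite bin_small//; lia. Qed.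

Lemma coef_oddbin n j : (oddbin n)`_j = 'C(n, j.*2.+1)%:R.
Proof. by rewrite coef_poly; case: ltnP => // nj; rewrite bin_small//; lia. Qed.

Lemma evenbinS n : evenbin n.+1 = evenbin n + 'X * oddbin n.
Proof.
apply/polyP => -[|j]; rewrite coefD coefXM !coef_evenbin ?coef_oddbin/=.
  by rewrite !bin0 addr0.
by rewrite doubleS binS natrD.
Qed.

Lemma oddbinS n : oddbin n.+1 = evenbin n + oddbin n.
Proof.
by apply/polyP => j; rewrite coefD coef_evenbin !coef_oddbin binS natrD addrC.
Qed.

Lemma evenbin0 : evenbin 0 = 1.
Proof. by apply/polyP => -[|j]; rewrite coef_evenbin coef1. Qed.

Lemma oddbin0 : oddbin 0 = 0.
Proof. by apply/polyP => j; rewrite coef_oddbin coef0. Qed.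

Lemma evenbin_oddbin n x :
  (evenbin n).[x ^+ 2] + x * (oddbin n).[x ^+ 2] = (1 + x) ^+ n.
Proof.
elim: n => [|n IH]; first by rewrite evenbin0 oddbin0 !hornerE.
by rewrite evenbinS oddbinS [RHS]exprS -IH !hornerE; ring.
Qed.

Lemma oddbin_expr n x : 2 * x * (oddbin n).[x ^+ 2] = (1 + x) ^+ n - (1 - x) ^+ n.
Proof.
by have := evenbin_oddbin n (- x); rewrite sqrrN -!evenbin_oddbin => <-; ring.
Qed.

(** De Moivre's formula (1 + i tan t)^n (cos t)^n = cos(nt) + i sin(nt), split into real and
    imaginary parts; -tan^2 t is (i tan t)^2. *)
Lemma trig_evenbin_oddbin n (t : R) : cos t != 0 ->
  (evenbin n).[- tan t ^+ 2] * cos t ^+ n = cos (n%:R * t) /\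
  (oddbin n).[- tan t ^+ 2] * tan t * cos t ^+ n = sin (n%:R * t).
Proof.
move=> c0; have st : sin t = tan t * cos t by rewrite /tan divfK.
elim: n => [|n [IHe IHo]].
  by rewrite evenbin0 oddbin0 -polyC1 hornerC horner0 !mul0r mul1r cos0 sin0.
rewrite -natr1 mulrDl mul1r cosD sinD -IHe -IHo st evenbinS oddbinS.
rewrite !hornerD hornerM hornerX [cos t ^+ n.+1]exprSr.
by split; ring.
Qed.

End OddEvenBinomials.

(** * Cauchy's cotangent sums *)

Section CauchyCotangents.
Local Open Scope classical_set_scope.
Variable R : realType.
Implicit Types (M N k p : nat).

Lemma sin_le_id (x : R) : 0 <= x -> sin x <= x.
Proof.
move=> x0; have [|c _] := @MVT_segment R sin cos 0 x x0 (fun y _ => is_derive_sin y).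
  exact/continuous_subspaceT/continuous_sin.
rewrite sin0 !subr0 => ->.
by rewrite ler_piMl// cos_le1.
Qed.

Lemma id_le_tan (x : R) : 0 <= x < pi / 2 -> x <= tan x.
Proof.
move=> /andP[x0 xpi].
have cos_gt0 y : y \in `[0, x]%R -> 0 < cos y.
  rewrite in_itv/= => /andP[y0 yx]; apply: cos_gt0_pihalf.
  by rewrite (le_lt_trans yx)// andbT (lt_le_trans _ y0)// oppr_lt0 divr_gt0// pi_gt0.
have [y yx||c cx] := @MVT_segment R tan (fun y => cos y ^- 2) 0 x x0.
- by apply: is_derive_tan; rewrite gt_eqF// cos_gt0// subset_itv_oo_cc.
- apply: derivable_within_continuous => y yx.
  by apply: derivable_tan; rewrite gt_eqF// cos_gt0.
rewrite tan0 !subr0 => ->; rewrite ler_peMl// invf_ge1 ?exprn_gt0 ?cos_gt0//.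
Qed.

(** With j = k + 1, the angles j pi / (2M + 1), which are zeros of sin((2M + 1) t); for k < M they
    lie strictly between 0 and pi/2. *)
Definition theta M k : R := k.+1%:R * pi / M.*2.+1%:R.
Definition cot2 M k : R := tan (theta M k) ^- 2.

Lemma theta_gt0 M k : 0 < theta M k.
Proof. by rewrite /theta !mulr_gt0// ?invr_gt0// ?pi_gt0. Qed.

Lemma theta_lt M k : (k < M)%N -> theta M k < pi / 2.
Proof.
move=> kM; have kM2 : k.+1%:R * 2 < M.*2.+1%:R :> R by rewrite -natrM ltr_nat; lia.
rewrite /theta ltr_pdivrMr// mulrAC ltr_pdivlMr// mulrAC [ltRHS]mulrC.
by rewrite ltr_pM2r ?pi_gt0.
Qed.

Lemma theta_inj M : injective (theta M).
Proof.
move=> k l /(congr1 (fun x => x * M.*2.+1%:R)); rewrite !divfK//.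
by move/(mulIf (lt0r_neq0 (pi_gt0 R)))/eqP; rewrite eqr_nat => /eqP[].
Qed.

Lemma theta_itv M k : (k < M)%N -> theta M k \in `](- (pi / 2)), (pi / 2)[%R.
Proof.
move=> kM; rewrite in_itv/= theta_lt// andbT (lt_trans _ (theta_gt0 M k))//.
by rewrite oppr_lt0 divr_gt0// pi_gt0.
Qed.

Lemma cos_theta_gt0 M k : (k < M)%N -> 0 < cos (theta M k).
Proof. by move/theta_itv; rewrite in_itv/= => /cos_gt0_pihalf. Qed.

Lemma tan_theta_gt0 M k : (k < M)%N -> 0 < tan (theta M k).
Proof.
move=> kM; rewrite (lt_le_trans (theta_gt0 M k))// id_le_tan// theta_lt// andbT.
exact/ltW/theta_gt0.
Qed.

Lemma sin_natmul_pi k : sin (k%:R * pi) = 0 :> R.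
Proof.
elim: k => [|k IH]; first by rewrite mul0r sin0.
by rewrite -natr1 mulrDl mul1r sinDpi IH oppr0.
Qed.

(** In the sine part of De Moivre's formula the left side has three factors; sin((2M + 1) theta) is
    0 while cos(theta) and tan(theta) are not. *)
Lemma root_oddbin_theta M k : (k < M)%N ->
  root (oddbin R M.*2.+1) (- tan (theta M k) ^+ 2).
Proof.
move=> kM; have c0 := lt0r_neq0 (cos_theta_gt0 kM).
have [_] := trig_evenbin_oddbin M.*2.+1 c0.
rewrite [X in sin X]mulrC divfK// sin_natmul_pi => /eqP.
by rewrite mulf_eq0 expf_eq0 (negPf c0) andbF orbF mulf_eq0
  (negPf (lt0r_neq0 (tan_theta_gt0 kM))) orbF.
Qed.

(** Both sides have degree at most M, take the value 2M + 1 at 0 and vanish at the M distinct points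
    -tan^2(theta_k), so their difference has M + 1 roots. *)
Lemma esympoly_cot2 M : M.*2.+1%:R *: esympoly (cot2 M) M = oddbin R M.*2.+1.
Proof.
apply/eqP; rewrite -subr_eq0; apply/eqP.
apply: (@roots_geq_poly_eq0 _ _ (0 :: [seq - tan (theta M k) ^+ 2 | k <- iota 0 M])).
- apply/andP; split.
    rewrite /root hornerD hornerN hornerZ !horner_coef0 -/(esymn _ _ _) esymn0.
    by rewrite coef_oddbin bin1 mulr1 subrr.
  apply/allP => x /mapP[k]; rewrite mem_iota add0n => /= kM ->{x}.
  rewrite /root hornerD hornerN (eqP (root_oddbin_theta kM)) subr0 hornerZ.
  rewrite horner_prod (bigD1 (Ordinal kM))//= hornerD hornerZ hornerX hornerC.
  by rewrite /cot2 mulrN mulVf ?subrr ?mul0r ?mulr0// expf_neq0 ?lt0r_neq0 ?tan_theta_gt0.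
- rewrite /= map_inj_in_uniq ?iota_uniq ?andbT => [|k l].
    apply/mapP => -[k]; rewrite mem_iota add0n => /= kM /eqP.
    by rewrite eq_sym oppr_eq0 expf_eq0 /= gt_eqF// tan_theta_gt0.
  rewrite !mem_iota !add0n => /= kM lM /oppr_inj /eqP.
  rewrite eqrXn2 ?ltW ?tan_theta_gt0// => /eqP /tan_inj.
  by move/(_ (theta_itv kM) (theta_itv lM))/theta_inj.
rewrite /= size_map size_iota (leq_trans (size_polyD _ _))// geq_max.
rewrite (leq_trans (size_scale_leq _ _)) ?size_esympoly// size_polyN.
by apply/leq_sizeP => j Mj; rewrite coef_oddbin bin_small//; lia.
Qed.

Lemma esymn_cot2 M p : esymn (cot2 M) M p = 'C(M.*2.+1, p.*2.+1)%:R / M.*2.+1%:R.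
Proof.
apply: (@mulfI _ M.*2.+1%:R) => //.
by rewrite [RHS]mulrC divfK// -coef_oddbin -esympoly_cot2 coefZ.
Qed.

End CauchyCotangents.

(** * The value of zeta({2}^p) *)

Section ZetaTwos.
Local Open Scope classical_set_scope.
Variable R : realType.
Implicit Types (M N k p : nat).

Lemma cvg_inv_odd : (fun M => M.*2.+1%:R^-1 : R) @ \oo --> (0 : R).
Proof.
apply: (squeeze_cvgr _ (cvg_cst 0) (@cvg_harmonic R)).
apply: nearW => M; rewrite invr_ge0 ler0n /= lef_pV2 ?posrE ?ltr0n// ler_nat ltnS.
by rewrite -addnn leq_addr.
Qed.

(** The ratio is a product of p factors 1 - i/(2M + 1), each tending to 1. *)
Lemma cvg_ffact_odd p :
  (fun M => (M.*2.+1 ^_ p)%:R / M.*2.+1%:R ^+ p : R) @ \oo --> (1 : R).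
Proof.
elim: p => [|p IH].
  by under eq_cvg do rewrite ffactn0 expr0 divr1; exact: cvg_cst.
rewrite [X in _ --> X](_ : _ = 1 * (1 - p%:R * 0)); last by rewrite mulr0 subr0 mulr1.
apply: (@cvg_trans _ ((fun M => (M.*2.+1 ^_ p)%:R / M.*2.+1%:R ^+ p *
                        (1 - p%:R * M.*2.+1%:R^-1) : R) @ \oo)).
  apply: near_eq_cvg; near=> M.
  have pM : (p <= M.*2.+1)%N.
    by rewrite -addnn -addnS (leq_trans _ (leq_addr _ _))//; near: M; exists p.
  rewrite ffactnSr natrM natrB// exprSr invfM mulrACA.
  by rewrite mulrBl divff// pnatr_eq0.
apply: cvgM => //; apply: cvgB; first exact: cvg_cst.
by apply: cvgM; [exact: cvg_cst|exact: cvg_inv_odd].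
Unshelve. all: by end_near. Qed.

Definition invpi2 k : R := (k.+1%:R * pi) ^- 2.

Lemma invpi2_ge0 k : 0 <= invpi2 k.
Proof. by rewrite invr_ge0 sqr_ge0. Qed.

(** Cauchy's sandwich cos^2(theta)/theta^2 <= cot^2(theta) <= 1/theta^2, from sin(theta) <= theta <=
    tan(theta), divided by (2M + 1)^2; the outer terms are [scaled_cos2] and [invpi2]. *)
Let scaled_cot2 M : nat -> R := M.*2.+1%:R ^- 2 *: cot2 R M.
Let scaled_cos2 M k : R := cos (theta R M k) ^+ 2 * invpi2 k.

Lemma invpi2_theta M k : invpi2 k = M.*2.+1%:R ^- 2 * theta R M k ^- 2.
Proof. by rewrite /invpi2 -invfM /theta -exprMn [M.*2.+1%:R * _]mulrC divfK. Qed.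

Lemma scaled_cot2_le M k : (k < M)%N -> 0 <= scaled_cot2 M k <= invpi2 k.
Proof.
move=> kM; rewrite (invpi2_theta M) [scaled_cot2 _ _]/(_ * cot2 R M k).
rewrite mulr_ge0 ?invr_ge0 ?sqr_ge0//= ler_wpM2l ?invr_ge0 ?sqr_ge0//.
rewrite lef_pV2 ?posrE ?exprn_gt0 ?theta_gt0 ?tan_theta_gt0//.
have t0 := ltW (theta_gt0 R M k).
by rewrite lerXn2r ?nnegrE// ?id_le_tan ?theta_lt ?t0// ltW ?tan_theta_gt0.
Qed.

Lemma scaled_cos2_le M k : (k < M)%N -> 0 <= scaled_cos2 M k <= scaled_cot2 M k.
Proof.
move=> kM; rewrite /scaled_cos2 mulr_ge0 ?sqr_ge0 ?invpi2_ge0//=.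
rewrite (invpi2_theta M) [scaled_cot2 _ _]/(_ * cot2 R M k) mulrCA.
rewrite ler_wpM2l ?invr_ge0 ?sqr_ge0// /cot2 /tan [(_ / cos _) ^+ 2]exprMn
  [leRHS]invfM exprVn invrK [leRHS]mulrC.
have s0 : 0 < sin (theta R M k).
  by rewrite sin_gt0_pihalf// theta_gt0 theta_lt.
rewrite ler_wpM2l ?sqr_ge0// lef_pV2 ?posrE ?exprn_gt0 ?theta_gt0//.
by rewrite lerXn2r ?nnegrE ?sin_le_id// ltW// theta_gt0.
Qed.

Lemma cvg_scaled_cos2 k : (fun M => scaled_cos2 M k) @ \oo --> invpi2 k.
Proof.
rewrite -[invpi2 k]mul1r; apply: cvgM; last exact: cvg_cst.
rewrite -(expr1n _ 2) -cos0.
apply: (@cvg_comp _ _ _ (fun M => cos (theta R M k)) (fun x => x ^+ 2));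
  last exact: exprn_continuous.
apply: (@cvg_comp _ _ _ (fun M => theta R M k) cos); last exact: continuous_cos.
rewrite -(mulr0 (k.+1%:R * pi)); apply: cvgM; first exact: cvg_cst.
exact: cvg_inv_odd.
Qed.

Lemma esymn_scaled_cot2 M p :
  esymn (scaled_cot2 M) M p =
  (M.*2.+1 ^_ p.*2.+1)%:R / M.*2.+1%:R ^+ p.*2.+1 * (p.*2.+1)`!%:R^-1.
Proof.
rewrite esymnZ esymn_cot2 -bin_ffact natrM exprVn -exprM mul2n exprSr invfM.
by rewrite mulrCA [RHS]mulrAC mulfK// pnatr_eq0 -lt0n fact_gt0.
Qed.

Lemma cvg_esymn_scaled_cot2 p :
  (fun M => esymn (scaled_cot2 M) M p) @ \oo --> ((p.*2.+1)`!%:R^-1 : R).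
Proof.
rewrite -[X in _ --> X]mul1r; under eq_cvg do rewrite esymn_scaled_cot2.
by apply: cvgM; [exact: cvg_ffact_odd|exact: cvg_cst].
Qed.

(** For M >= N, [esymn] can only grow when [scaled_cos2] is replaced by [scaled_cot2] and then N by
    M terms; M tends to infinity with N fixed. *)
Lemma esymn_invpi2_le N p : esymn invpi2 N p <= (p.*2.+1)`!%:R^-1.
Proof.
apply: (@ler_cvg_to _ \oo _ R (fun M => esymn (scaled_cos2 M) N p)
  (fun M => esymn (scaled_cot2 M) M p)).
- exact/cvg_esymn/cvg_scaled_cos2.
- exact: cvg_esymn_scaled_cot2.
near=> M; have NM : (N <= M)%N by near: M; exists N.
rewrite (@le_trans _ _ (esymn (scaled_cot2 M) N p))//.
  by apply: le_esymn => k kN; rewrite scaled_cos2_le// (leq_trans kN).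
by apply: esymn_widen => // k /scaled_cot2_le/andP[].
Unshelve. all: by end_near. Qed.

(** On its first N terms [invpi2] dominates [scaled_cot2 N], whose symmetric functions already tend
    to the upper bound [esymn_invpi2_le]. *)
Lemma cvg_esymn_invpi2 p : (fun N => esymn invpi2 N p) @ \oo --> ((p.*2.+1)`!%:R^-1 : R).
Proof.
apply: (squeeze_cvgr _ (@cvg_esymn_scaled_cot2 p) (cvg_cst _)).
apply: nearW => N; rewrite esymn_invpi2_le andbT.
by apply: le_esymn => k; exact: scaled_cot2_le.
Qed.

Definition zeta2 p : R := pi ^+ p.*2 / (p.*2.+1)`!%:R.

Lemma total_Li2 p : total (Li2 R p) = (zeta2 p)%:E.
Proof.
have Li2_ge0 n : 0 <= Li2 R p n by rewrite -Li_nseq2 Li_ge0.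
rewrite /total -nneseries_esumT => [|n]; last by rewrite lee_fin.
apply/cvg_lim => //; apply/fine_cvgP; split.
  by apply: nearW => N; rewrite sumEFin.
rewrite (_ : fine \o _ = psum (Li2 R p)); last first.
  by apply/funext => N; rewrite /= sumEFin big_mkord.
rewrite -(cvg_shiftS (psum (Li2 R p))).
have E : (fun k => k.+1%:R ^- 2) = pi ^+ 2 *: invpi2.
  apply/funext => k; rewrite -[RHS]/(_ * invpi2 k) /invpi2 [(_ * pi) ^+ 2]exprMn.
  by rewrite [(_ * pi ^+ 2)^-1]invfM mulrCA mulfV ?mulr1// expf_neq0// lt0r_neq0 ?pi_gt0.
rewrite (_ : [sequence _]_n = fun N => pi ^+ p.*2 * esymn invpi2 N p); last first.
  by apply/funext => N; rewrite [LHS]psum_Li2 E esymnZ -exprM mul2n.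
by apply: cvgM; [exact: cvg_cst|exact: cvg_esymn_invpi2].
Qed.

End ZetaTwos.

(** * Comparison of coefficients *)

Section Coefficients.
Variable R : realType.

Lemma oddbin_sqr_homogeneous m (a b : R) : 0 < a -> 0 < b -> a ^+ 2 + b ^+ 2 = 1 ->
  \sum_(p < m.+1) 'C(m.*2.+2, p.*2.+1)%:R * (a ^+ 2) ^+ p * (b ^+ 2) ^+ (m - p) =
  2 * (oddbin R m.+1).[4 * a ^+ 2 * b ^+ 2].
Proof.
move=> a0 b0 ab; have an0 := lt0r_neq0 a0; have bn0 := lt0r_neq0 b0.
(* Factoring out b^(2m) leaves a polynomial in (a/b)^2. *)
have -> : \sum_(p < m.+1) 'C(m.*2.+2, p.*2.+1)%:R * (a ^+ 2) ^+ p * (b ^+ 2) ^+ (m - p) =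
    b ^+ m.*2 * (oddbin R m.*2.+2).[(a / b) ^+ 2].
  rewrite (@horner_coef_wide _ m.+1); last first.
    by apply/leq_sizeP => j mj; rewrite coef_oddbin bin_small//; lia.
  rewrite mulr_sumr; apply: eq_bigr => p _; rewrite coef_oddbin -mulrA [RHS]mulrCA.
  congr (_ * _); have pm : (p <= m)%N by rewrite -ltnS.
  have -> : b ^+ m.*2 = (b ^+ 2) ^+ (m - p) * (b ^+ 2) ^+ p.
    by rewrite -exprD subnK// -exprM mul2n.
  rewrite [(a / b) ^+ 2]expr_div_n expr_div_n -mulrA [X in _ = _ * X]mulrC.
  by rewrite divfK ?expf_neq0// mulrC.
(* The factor 2ab makes both sides differences of powers, by [oddbin_expr] with x = a/b on the left
   and x = 2ab on the right. *)
apply: (@mulfI _ (2 * a * b)); first by rewrite !mulf_neq0.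
have -> : 2 * a * b * (b ^+ m.*2 * (oddbin R m.*2.+2).[(a / b) ^+ 2]) =
    b ^+ m.*2.+2 * (2 * (a / b) * (oddbin R m.*2.+2).[(a / b) ^+ 2]).
  by rewrite !exprS; field.
have -> : 4 * a ^+ 2 * b ^+ 2 = (2 * a * b) ^+ 2 by ring.
rewrite [RHS]mulrA [2 * a * b * 2]mulrC !oddbin_expr mulrBr -!exprMn.
have -> : b * (1 + a / b) = b + a by field.
have -> : b * (1 - a / b) = b - a by field.
rewrite -doubleS -mul2n !exprM; congr (_ ^+ _ - _ ^+ _).
  by transitivity (a ^+ 2 + b ^+ 2 + 2 * a * b); [ring | rewrite ab].
by transitivity (a ^+ 2 + b ^+ 2 - 2 * a * b); [ring | rewrite ab].
Qed.

Lemma LiP_total m (X Y : R) : 0 <= X -> 0 <= Y ->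
  total (LiP X Y m) =
  (\sum_(p < m.+1) X ^+ p * Y ^+ (m - p) * (zeta2 R p * zeta2 R (m - p)))%:E.
Proof.
move=> X0 Y0; have Li2_ge0 p n : 0 <= Li2 R p n by rewrite -Li_nseq2 Li_ge0.
rewrite /LiP /hsum total_sum => [|p n]; last first.
  rewrite -[(_ *: _) n]/(_ * conv _ _ n).
  by rewrite !mulr_ge0 ?exprn_ge0// conv_ge0.
rewrite -sumEFin; apply: eq_bigr => p _.
rewrite totalZ ?mulr_ge0 ?exprn_ge0//; last exact: conv_ge0.
by rewrite (total_conv _ _ (total_Li2 _ _))// !total_Li2 -!EFinM.
Qed.

(** For p + q = m, 1/((2p+1)! (2q+1)!) is the binomial of 2m+2 over 2p+1 divided by (2m+2)!. *)
Lemma zeta2_conv m (a b : R) : 0 < a -> 0 < b -> a ^+ 2 + b ^+ 2 = 1 ->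
  \sum_(p < m.+1) (a ^+ 2) ^+ p * (b ^+ 2) ^+ (m - p) * (zeta2 R p * zeta2 R (m - p)) =
  (2 * pi ^+ m.*2 / (m.*2.+2)`!%:R) * (oddbin R m.+1).[4 * a ^+ 2 * b ^+ 2].
Proof.
move=> a0 b0 ab.
rewrite [RHS]mulrAC [2 * _ * _]mulrAC -[RHS]mulrA -oddbin_sqr_homogeneous//.
rewrite mulr_suml; apply: eq_bigr => p _.
have pm : (p <= m)%N by rewrite -ltnS.
have f0 k : k`!%:R != 0 :> R by rewrite pnatr_eq0 -lt0n fact_gt0.
have -> : (m.*2.+2)`!%:R = 'C(m.*2.+2, p.*2.+1)%:R *
    ((p.*2.+1)`!%:R * ((m - p).*2.+1)`!%:R) :> R.
  rewrite -!natrM -(@bin_fact m.*2.+2 p.*2.+1); last by lia.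
  by congr (_ * (_ * _`!))%:R; lia.
have -> : pi ^+ m.*2 = pi ^+ p.*2 * pi ^+ (m - p).*2 :> R.
  by rewrite -exprD -doubleD subnKC.
have c0 : 'C(m.*2.+2, p.*2.+1)%:R != 0 :> R by rewrite pnatr_eq0 -lt0n bin_gt0; lia.
rewrite /zeta2; field.
by rewrite !f0 c0.
Qed.

Lemma LiT_ge0 m k n : 0 <= LiT R m k n.
Proof.
rewrite /LiT; case: ifP => // _; rewrite /Liins fct_sumE.
by apply: sumr_ge0 => s _; exact: Li_ge0.
Qed.

Lemma sum_total_LiT m (w : R) : 0 < w < 1 ->
  (\sum_(k < m.+1) (w ^+ k)%:E * total (LiT R m k) =
  ((2 * pi ^+ m.*2 / (m.*2.+2)`!%:R) * (oddbin R m.+1).[w])%:E)%E.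
Proof.
move=> /andP[w0 w1]; pose s := Num.sqrt (1 - w).
have s2 : s ^+ 2 = 1 - w by rewrite sqr_sqrtr// subr_ge0 ltW.
have s0 : 0 < s by rewrite sqrtr_gt0 subr_gt0.
have s1 : s < 1 by rewrite -(@ltr_pXn2r _ 2) ?nnegrE ?ltW// s2 expr1n gtrBl.
(* The roots of z^2 - z + w/4, so that X + Y = 1 and 4XY = w; both are positive because 0 < w <
   1. *)
pose X := (1 + s) / 2; pose Y := (1 - s) / 2.
have X0 : 0 < X by rewrite /X; lra.
have Y0 : 0 < Y by rewrite /Y; lra.
have XY1 : X + Y = 1 by rewrite /X /Y; lra.
have wXY : w = 4 * X * Y by rewrite /X /Y; nra.
have EX : Num.sqrt X ^+ 2 = X by rewrite sqr_sqrtr// ltW.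
have EY : Num.sqrt Y ^+ 2 = Y by rewrite sqr_sqrtr// ltW.
have := @zeta2_conv m (Num.sqrt X) (Num.sqrt Y).
rewrite !sqrtr_gt0 EX EY -wXY => /(_ X0 Y0 XY1) <-.
rewrite -(LiP_total _ (ltW X0) (ltW Y0)).
have [-> _] := LiPF_expansion XY1 (leqnn m.+1).
rewrite -wXY total_sum => [|k n]; last first.
  by rewrite -[(_ *: _) n]/(_ * LiT R m k n) mulr_ge0 ?exprn_ge0 ?LiT_ge0// ltW.
by apply: eq_bigr => k _; rewrite totalZ ?exprn_ge0//; [rewrite ltW|exact: LiT_ge0].
Qed.

(** At w = 1/2 the terms in [sum_total_LiT] are nonnegative with a real sum, so each is finite. *)
Lemma total_LiT_fin_num m k : (k < m.+1)%N -> total (LiT R m k) \is a fin_num.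
Proof.
move=> km; have w01 : 0 < (2^-1 : R) < 1 by lra.
have w0 : 0 < (2^-1 : R) by case/andP: w01.
have := @sum_total_LiT m _ w01; rewrite (bigD1 (Ordinal km))//=.
set r := (X in _ = X%:E) => E.
have T0 i : (0 <= (2^-1 ^+ i)%:E * total (LiT R m i))%E.
  by rewrite mule_ge0 ?total_ge0 ?lee_fin ?exprn_ge0 ?ltW// => n; exact: LiT_ge0.
have : ((2^-1 ^+ k)%:E * total (LiT R m k) \is a fin_num)%E.
  rewrite ge0_fin_numE//; apply: (le_lt_trans _ (ltry r)); rewrite -E leeDl//.
  by apply: sume_ge0 => i _.
have := total_ge0 (LiT_ge0 m k); case: (total _) => [x||] //.
by rewrite gt0_muley// lte_fin exprn_gt0.
Qed.

Lemma total_LiT m k : (k < m.+1)%N ->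
  total (LiT R m k) = (2 * pi ^+ m.*2 / (m.*2.+2)`!%:R * 'C(m.+1, k.*2.+1)%:R)%:E.
Proof.
move=> km; pose t := \poly_(i < m.+1) fine (total (LiT R m i)).
pose o := (2 * pi ^+ m.*2 / (m.*2.+2)`!%:R) *: oddbin R m.+1.
suff E : t = o.
  rewrite -[total _]fineK ?total_LiT_fin_num//; congr (_%:E).
  by have := congr1 (fun q : {poly R} => q`_k) E; rewrite coef_poly km coefZ coef_oddbin.
apply/eqP; rewrite -subr_eq0; apply/eqP.
(* Both polynomials have size at most m + 2, and [sum_total_LiT] makes them agree at the m + 2
   points 1/2, ..., 1/(m + 3) of (0, 1). *)
apply: (@roots_geq_poly_eq0 _ _ [seq i.+2%:R^-1 | i <- iota 0 m.+2]).
- apply/allP => x /mapP[i _ ->]; rewrite /root hornerD hornerN hornerZ.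
  set w : R := i.+2%:R^-1.
  have w01 : 0 < w < 1 by rewrite invr_gt0 ltr0n invf_lt1// ltr1n.
  have [] := @sum_total_LiT m _ w01.
  under eq_bigr => j _ do rewrite -[total _]fineK ?total_LiT_fin_num// -EFinM.
  rewrite sumEFin => -[<-]; rewrite horner_poly subr_eq0; apply/eqP.
  by apply: eq_bigr => j _; rewrite mulrC.
- rewrite map_inj_uniq ?iota_uniq// => i j /invr_inj/eqP.
  by rewrite eqr_nat => /eqP[].
rewrite size_map size_iota (leq_trans (size_polyD _ _))// geq_max size_polyN.
rewrite (leq_trans (size_poly _ _))//= (leq_trans (size_scale_leq _ _))//.
by rewrite (leq_trans (size_poly _ _)).
Qed.

Lemma total_LiT_zeta2 m k : (k.*2 <= m)%N ->
  total (LiT R m k) = (zeta2 R m * 'C(m, k.*2)%:R / k.*2.+1%:R)%:E.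
Proof.
move=> km; rewrite total_LiT; last by lia.
have f0 j : j`!%:R != 0 :> R by rewrite pnatr_eq0 -lt0n fact_gt0.
have E : m.+1%:R * 'C(m, k.*2)%:R = k.*2.+1%:R * 'C(m.+1, k.*2.+1)%:R :> R.
  by rewrite -!natrM mul_bin_diag.
have -> : 'C(m.+1, k.*2.+1)%:R = m.+1%:R * 'C(m, k.*2)%:R / k.*2.+1%:R :> R.
  by rewrite E mulrC mulKf.
rewrite /zeta2 factS natrM (_ : m.*2.+2%:R = 2 * m.+1%:R); last by rewrite -natrM mul2n.
congr (_%:E); field.
by rewrite f0 -!(natrD _ 1) -?natrM -?natrD !pnatr_eq0.
Qed.

End Coefficients.

(** * Compositions, their cyclic shifts and the final count *)

Section Compositions.
Local Open Scope nat_scope.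

Lemma perm_compositions r k :
  perm_eq [seq [seq val i | i <- s] | s : r.-tuple 'I_k.+1 in compositions r k] (comps r k).
Proof.
apply: uniq_perm; last 1 first.
- move=> s; rewrite mem_comps; apply/mapP/andP.
    case=> t; rewrite mem_enum inE => /eqP sumt ->; rewrite size_map size_tuple eqxx.
    by split=> //; apply/eqP; rewrite sumnE big_map big_tuple.
  case=> /eqP szs /eqP sums.
  (* Entries are at most the sum, so [inord] below changes no value. *)
  have le_k i : i \in s -> i < k.+1.
    rewrite ltnS -sums; elim: s {szs sums} => //= a s IH.
    by rewrite inE => /predU1P[->|/IH/leq_trans-> //]; rewrite ?leq_addr ?leq_addl.
  have szt : size [seq inord i : 'I_k.+1 | i <- s] == r by rewrite size_map szs.
  have E : s = [seq val i | i <- Tuple szt].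
    rewrite /= -map_comp -[LHS]map_id; apply/eq_in_map => i /le_k ik /=.
    by rewrite inordK.
  exists (Tuple szt) => //; rewrite mem_enum inE; apply/eqP.
  by transitivity (sumn s) => //; rewrite [in RHS]E sumnE big_map big_tuple.
- rewrite map_inj_uniq ?enum_uniq// => s t /inj_map st.
  by apply/val_inj/st/val_inj.
exact: comps_uniq.
Qed.

Lemma perm_rot_comps r k j : perm_eq [seq rot j s | s <- comps r k] (comps r k).
Proof.
apply: uniq_perm; rewrite ?map_inj_uniq ?comps_uniq//; first exact: rot_inj.
move=> s; apply/mapP/idP => [[t + ->]|].
  by rewrite !mem_comps size_rot (perm_sumn (_ : perm_eq (rot j t) t)) ?perm_rot.
rewrite mem_comps => H; exists (rotr j s); last by rewrite rotrK.
by rewrite mem_comps size_rotr (perm_sumn (_ : perm_eq (rotr j s) s)) ?perm_rotr.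
Qed.

Lemma card_compositions r k : #|compositions r.+1 k| = 'C(r + k, r).
Proof.
rewrite -card_ord_partitions; apply: eq_card => t.
by rewrite !inE big_tuple.
Qed.

End Compositions.

Lemma sum_compositions (R : realType) r k (phi : seq nat -> R) :
  \sum_(s in compositions r k) phi (nat_tuple s) = \sum_(s <- comps r k) phi s.
Proof.
by rewrite -(perm_big _ (perm_compositions r k)) big_map big_enum.
Qed.

Lemma sum_mzv_insert2 (R : realType) m n : (n.*2 <= m)%N ->
  \sum_(s <- comps n.*2.+1 (m - n.*2)) mzv R (insert2 true s) =
  zeta2 R m * 'C(m, n.*2)%:R / n.*2.+1%:R.
Proof.
move=> nm; have := total_LiT_zeta2 R nm.
rewrite /LiT nm /Liins /= odd_double total_sum => [E|s k]; last exact: Li_ge0.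
set r := (X in _ = X%:E) in E.
(* [mzv] goes through [fine], so each summand has to be finite; it is bounded by the real sum
   [r]. *)
have fin s : s \in comps n.*2.+1 (m - n.*2) ->
    total (Li R (insert2 true s)) \is a fin_num.
  move=> s_in; have T0 t : (0 <= total (Li R (insert2 true t)))%E.
    by apply: total_ge0; exact: Li_ge0.
  rewrite ge0_fin_numE//; apply: (le_lt_trans _ (ltry r)); rewrite -E.
  by rewrite (big_rem s)//= leeDl// sume_ge0.
apply: EFin_inj; rewrite -E -sumEFin big_seq [RHS]big_seq.
by apply: eq_bigr => s s_in; rewrite mzv_total fineK ?fin.
Qed.

Lemma Z_single (R : realType) m : Z R (n := 0) [tuple m] = zeta2 R m.
Proof. by rewrite /Z /Zarg /= cats0 mzv_total Li_nseq2 total_Li2. Qed.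

Lemma cyclic_sumE (R : realType) n (s : (n.*2.+1).-tuple nat) :
  cyclic_sum R s = \sum_(j < n.*2.+1) mzv R (insert2 true (rot j s)).
Proof.
rewrite /cyclic_sum /Z Zarg_insert2 -(big_mkord xpredT (fun j => mzv R (insert2 true (rot j s)))).
rewrite big_ltn// rot0; congr (_ + _).
by apply: eq_bigr => j _; rewrite Zarg_insert2.
Qed.

Theorem theorem5p1 (R : realType) (m n : nat) (hmn : (n.*2 <= m)%N) :
  \sum_(s in compositions n.*2.+1 (m - n.*2)) cyclic_sum R (nat_tuple s)
    = Z R (n := 0) [tuple m] * #|compositions n.*2.+1 (m - n.*2)|%:R
  /\ Z R (n := 0) [tuple m] * #|compositions n.*2.+1 (m - n.*2)|%:R
    = Z R (n := 0) [tuple m] * 'C(m, n.*2)%:R.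
Proof.
rewrite card_compositions subnKC//; split=> //.
under eq_bigr => s _ do rewrite cyclic_sumE.
rewrite exchange_big /=.
(* Rotation by j permutes the compositions, so the inner sum does not depend on j. *)
under eq_bigr => j _.
  rewrite (@sum_compositions _ _ _ (fun s => mzv R (insert2 true (rot j s)))).
  rewrite -(big_map (rot j) xpredT (fun s => mzv R (insert2 true s))).
  rewrite (perm_big _ (perm_rot_comps _ _ j)) sum_mzv_insert2//.
  over.
(* The 2n + 1 equal terms cancel the denominator 2n + 1. *)
by rewrite sumr_const card_ord -[LHS]mulr_natr divfK ?pnatr_eq0// Z_single.
Qed.
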